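(* Let $\Gamma$ be a countable dense subgroup of $SU(2)$, and let $m_{SU(2)}$ be the Haar probability measure on $SU(2)$. Then the translation action $\Gamma\curvearrowright(SU(2),m_{SU(2)})$ is totally ergodic but not directionally expansive. In particular, $\Gamma$ does not have the cyclic escape property. Consequently, every countable free group of rank at least two fails to have the cyclic escape property.
   Context: The translation action is by left multiplication. All unitary representations are on complex Hilbert spaces. For a unitary representation $(V,\pi)$ of a countable group $G$ and a subgroup $H\leq G$, write $V^H=\{v\in V:\pi(h)v=v\text{ for every }h\in H\}$ and let $P_H$ be the orthogonal projection onto $V^H$. The representation $(V,\pi)$ is totally ergodic if $V^H=\{0\}$ for every finite-index subgroup $H\leq G$. An infinite countable group $G$ has the cyclic escape property if, for every totally ergodic unitary representation $(V,\pi)$ of $G$ and every $v\in V$, $\inf_C\|P_Cv\|=0$, where the infimum is over all infinite cyclic subgroups $C\leq G$. A probability-measure-preserving action $G\curvearrowright(X,\mu)$ of a countable discrete group is totally ergodic if its restriction to every finite-index subgroup of $G$ is ergodic. It is directionally expansive if, for every measurable set $B\subset X$ with $\mu(B)>0$ and every $\varepsilon>0$, there exists a cyclic subgroup $C\leq G$ (finite or infinite) such that $\mu(CB)>1-\varepsilon$, where $CB=\bigcup_{c\in C}cB$. *)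

(* Defs.v *)
From HB Require Import structures.
From mathcomp Require Import all_boot all_order all_algebra spectral.
From mathcomp Require Import complex.
From mathcomp Require Import all_classical all_reals all_analysis.

Set Implicit Arguments.
Unset Strict Implicit.
Unset Printing Implicit Defensive.
Import Order.TTheory GRing.Theory Num.Theory.
Import numFieldNormedType.Exports.
Local Open Scope classical_set_scope.
Local Open Scope ring_scope.

Definition subgroup_type (G : groupType) (H : groupClosed G) : Type :=
  {x : G | x \in H}.

Section subgroup_type.
Context (G : groupType) (H : groupClosed G).

HB.instance Definition _ := [isSub of subgroup_type H for @sval _ _].
HB.instance Definition _ := [Choice of subgroup_type H by <:].

Lemma subgroup_closed : group_closed (fun x : G => x \in H).
Proof. by split; [exact: gpred1 | exact: gpredF]. Qed.

HB.instance Definition _ :=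
  SubChoice_isSubGroup.Build G (fun x => x \in H) (subgroup_type H)
    subgroup_closed.

End subgroup_type.

Definition finite_index (G : groupType) (H : groupClosed G) : Prop :=
  finite_set [set [set (g * h)%g | h in [set` H]] | g in [set: G]].

Definition cyclic_subgroup (G : groupType) (C : groupClosed G) : Prop :=
  exists g : G, [set` C] = [set x | exists n, x = (g ^+ n)%g \/ x = (g ^- n)%g].

(* [F] is free on the family [iota]: universal property of free groups. *)
Definition free_basis (F : groupType) (S : Type) (iota : S -> F) : Prop :=
  forall (K : groupType) (f : S -> K),
    exists! phi : F -> K,
      {morph phi : x y / (x * y)%g} /\ (forall s, phi (iota s) = f s).

(* The complex field as a [numClosedFieldType] structure: this makes the
   topology that MathComp-Analysis puts on such a field available. *)
Definition Cplx (R : realType) : numClosedFieldType := R[i].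

Section unitary_representation.
Context (R : realType) (V : completeNormedModType (Cplx R)).

(* [V], complete for its norm, is a Hilbert space with inner product [dot],
   linear in its first argument, when the norm is the one of [dot]. *)
Definition hilbert (dot : {dot V for Num.conj}) : Prop :=
  forall v : V, `|v| ^+ 2 = dot v v.

Definition unitary_rep (dot : {dot V for Num.conj}) (G : groupType)
    (pi : G -> V -> V) : Prop :=
  [/\ forall g, linear (pi g),
      pi 1%g = id,
      forall g h, pi (g * h)%g = pi g \o pi h &
      forall g u v, dot (pi g u) (pi g v) = dot u v].

Definition fixed_vectors (G : groupType) (pi : G -> V -> V)
    (H : groupClosed G) : set V :=
  [set v | forall h, h \in H -> pi h v = v].

(* [xget 0] picks the element of a set, here a singleton as soon as [W] is a
   closed subspace of a Hilbert space. *)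
Definition orthogonal_projection (dot : {dot V for Num.conj}) (W : set V)
    (v : V) : V :=
  xget 0 [set w | W w /\ forall u, W u -> dot (v - w) u = 0].

Definition totally_ergodic_rep (G : groupType) (pi : G -> V -> V) : Prop :=
  forall H : groupClosed G, finite_index H -> fixed_vectors pi H = [set 0].

End unitary_representation.

(* The infiniteness and countability of [G] are not part of this predicate: they
   are standing assumptions on the groups it is applied to.
   The norm of [V] is valued in the nonnegative part of [Cplx R], hence the real
   part. The infimum is taken in the extended reals so that it is [+oo], not
   [0], for a group without infinite cyclic subgroups. *)
Definition cyclic_escape_property (R : realType) (G : groupType) : Prop :=
  forall (V : completeNormedModType (Cplx R)) (dot : {dot V for Num.conj})
    (pi : G -> V -> V),
    hilbert dot -> unitary_rep dot pi -> totally_ergodic_rep pi ->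
  forall v : V,
    ereal_inf [set r | exists C : groupClosed G,
      [/\ cyclic_subgroup C, infinite_set [set` C] &
          r = (complex.Re
                 `|orthogonal_projection dot (fixed_vectors pi C) v|)%:E]]
    = 0%:E.

Section pmp_action.
Context (R : realType) (d : measure_display) (X : measurableType d).
Context (mu : probability X R) (G : groupType) (act : G -> X -> X).

Definition pmp_action : Prop :=
  [/\ act 1%g = id,
      forall g h, act (g * h)%g = act g \o act h,
      forall g, measurable_fun setT (act g) &
      forall g B, measurable B -> mu (act g @^-1` B) = mu B].

(* Ergodicity of the restriction of the action to [H]. *)
Definition ergodic_on (H : groupClosed G) : Prop :=
  forall B : set X, measurable B ->
    (forall h, h \in H -> act h @` B = B) -> mu B = 0%:E \/ mu B = 1%:E.

Definition totally_ergodic_action : Prop :=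
  forall H : groupClosed G, finite_index H -> ergodic_on H.

Definition directionally_expansive : Prop :=
  forall (B : set X) (eps : R), measurable B -> (0%:E < mu B)%E -> 0 < eps ->
    exists C : groupClosed G, cyclic_subgroup C /\
      ((1 - eps)%:E < mu (\bigcup_(c in [set` C]) (act c @` B)))%E.

End pmp_action.

Definition special_unitary (R : realType) : set 'M[Cplx R]_2 :=
  [set A | A \is unitarymx /\ \det A = 1].

(* [set_type] carries the topology induced by the ambient matrices. *)
Definition SU2 (R : realType) : Type := set_type (@special_unitary R).

Section SU2_group.
Context (R : realType).

HB.instance Definition _ := Choice.on (SU2 R).
HB.instance Definition _ := Topological.copy (SU2 R)
  (set_type (@special_unitary R)).

Definition SU2_mx (x : SU2 R) : 'M[Cplx R]_2 := sval x.

Lemma SU2_mxP (x : SU2 R) : SU2_mx x \is unitarymx /\ \det (SU2_mx x) = 1.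
Proof. by case: x => A /= /set_mem. Qed.

Lemma SU2_mx_inj : injective SU2_mx.
Proof. exact: val_inj. Qed.

Fact SU2_one_subproof :
  (1%:M : 'M[Cplx R]_2) \in @special_unitary R.
Proof.
by apply/mem_set; split; [apply/unitarymxP; rewrite mul1mx trmx1 map_mx1 | rewrite det1].
Qed.

Fact SU2_mul_subproof (x y : SU2 R) :
  SU2_mx x *m SU2_mx y \in @special_unitary R.
Proof.
have [xU xD] := SU2_mxP x; have [yU yD] := SU2_mxP y.
by apply/mem_set; split; [exact: mul_unitarymx | rewrite det_mulmx xD yD mulr1].
Qed.

Fact SU2_inv_subproof (x : SU2 R) : invmx (SU2_mx x) \in @special_unitary R.
Proof.
have [xU xD] := SU2_mxP x.
by apply/mem_set; split;
  [rewrite invmx_unitary // trmxC_unitary | rewrite det_inv xD invr1].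
Qed.

Definition SU2_one : SU2 R := SigSub SU2_one_subproof.
Definition SU2_mul (x y : SU2 R) : SU2 R := SigSub (SU2_mul_subproof x y).
Definition SU2_inv (x : SU2 R) : SU2 R := SigSub (SU2_inv_subproof x).

Fact SU2_mulA : associative SU2_mul.
Proof. by move=> x y z; apply: SU2_mx_inj; exact: mulmxA. Qed.

Fact SU2_mul1 : left_id SU2_one SU2_mul.
Proof. by move=> x; apply: SU2_mx_inj; exact: mul1mx. Qed.

Fact SU2_mulr1 : right_id SU2_one SU2_mul.
Proof. by move=> x; apply: SU2_mx_inj; exact: mulmx1. Qed.

Fact SU2_mulV : left_inverse SU2_one SU2_inv SU2_mul.
Proof.
by move=> x; apply: SU2_mx_inj; apply: mulVmx; have [/unitarymx_unit] := SU2_mxP x.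
Qed.

Fact SU2_mulrV : right_inverse SU2_one SU2_inv SU2_mul.
Proof.
by move=> x; apply: SU2_mx_inj; apply: mulmxV; have [/unitarymx_unit] := SU2_mxP x.
Qed.

HB.instance Definition _ := isGroup.Build (SU2 R)
  SU2_mulA SU2_mul1 SU2_mulr1 SU2_mulV SU2_mulrV.
HB.instance Definition _ := isPointed.Build (SU2 R) SU2_one.

End SU2_group.

Definition SU2_borel (R : realType) :=
  g_sigma_algebraType (@open (SU2 R)).

(* On a compact group, left invariance characterizes the Haar measure among Borel
   probability measures. *)
Definition haar_probability (R : realType) (m : probability (SU2_borel R) R) :
    Prop :=
  forall (g : SU2 R) (B : set (SU2_borel R)), measurable B ->
    m [set (g * x)%g | x in B] = m B.

Definition translation (R : realType) (Gamma : groupClosed (SU2 R))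
    (g : subgroup_type Gamma) (x : SU2_borel R) : SU2_borel R :=
  (val g * x)%g.

(* Main.v *)
From HB Require Import structures.
Require Import Defs.
From mathcomp Require Import all_boot all_order all_algebra spectral.
From mathcomp Require Import complex ring zify.
From mathcomp Require Import all_classical all_reals all_analysis.
From mathcomp Require Import measurable_realfun.
Set Implicit Arguments.
Unset Strict Implicit.
Unset Printing Implicit Defensive.
Import Order.TTheory GRing.Theory Num.Theory.
Import numFieldNormedType.Exports.
Local Open Scope classical_set_scope.
Local Open Scope ring_scope.
Local Open Scope sesquilinear_scope.

(** The negative results rest on two features of SU(2): every element has a
    fixed axis in the adjoint representation, and every element is inverted by
    some half turn.

    Cyclic escape.  SU(2) acts by conjugation on the three-dimensional space of
    traceless matrices.  Each element commutes with its own traceless part, so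
    it fixes a nonzero vector of this space, its axis.  A single vector of the
    space may be orthogonal to axes; therefore the representation used is the sum
    of three copies, realized as 3 x 3 matrices with rows rotated simultaneously,
    and the vector is the identity matrix.  If a is a unit vector on the axis of
    g, then u = a^* a is a fixed unit vector and <1, u> = 1, hence the projection
    of 1 to the fixed vectors of any cyclic group has norm at least 1
    ([adjoint_rep_projection]).  A homomorphism from a group G to SU(2) thus
    refutes the cyclic escape property of G as soon as only scalar matrices
    commute with the image of each finite-index subgroup ([not_cyclic_escape]).

    For a dense subgroup, the closure of a finite-index subgroup H has finite
    index in SU(2).  By pigeonhole it contains the n-th power of every element
    for some fixed n > 0; every element of SU(2) is an n-th power, so H is dense
    ([finite_index_dense]).  For a free group, two free generators are sent to
    rotations about distinct axes, no positive powers of which are central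
    ([independent_rotations]); a finite-index subgroup contains positive powers of
    both generators.

    Total ergodicity thus means that a dense subgroup H is ergodic for the Haar
    measure mu ([dense_subgroup_ergodic]).  If B is H-invariant then so is
    A |-> mu (A `&` B), hence invariant under all translations: for open sets by
    approximation from inside, for Borel sets by uniqueness of measures.  So
    mu (g^-1 A `&` B) = mu (A `&` B) for all g; for A the complement of B the right
    side vanishes, and integrating the left side over g with Fubini gives
    mu B * mu (A^-1) = 0.  Exchanging A and B shows that mu B is 0 or 1.

    Directional expansiveness fails for a small neighbourhood V of 1.  Given g
    there is y in SU(2) with y^2 = -1 and y g = g^-1 y.  For every power c of g
    then (y^-1 c)^2 = -1, which keeps y^-1 c away from 1, uniformly in g.  So yV
    is disjoint from CV, where C is generated by g, and mu (CV) <= 1 - mu V. *)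

(** * Two by two unitary matrices *)

Section matrices22.
Variable C : numClosedFieldType.
Implicit Types A X : 'M[C]_2.

Definition mx22 (a b c d : C) : 'M[C]_2 :=
  \matrix_(i, j) if i == 0 then (if j == 0 then a else b)
                 else (if j == 0 then c else d).

Lemma mx22E A : A = mx22 (A 0 0) (A 0 1) (A 1 0) (A 1 1).
Proof.
apply/matrixP => i j; rewrite mxE.
have D (k : 'I_2) : k = 0 \/ k = 1.
  by case: k => [[|[|//]] lek]; [left|right]; apply: val_inj.
by case: (D i) => ->; case: (D j) => ->.
Qed.

Lemma mx22P A X : A 0 0 = X 0 0 -> A 0 1 = X 0 1 -> A 1 0 = X 1 0 ->
  A 1 1 = X 1 1 -> A = X.
Proof. by move=> e1 e2 e3 e4; rewrite (mx22E A) (mx22E X) e1 e2 e3 e4. Qed.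

Lemma mulmx22 A X (i j : 'I_2) : (A *m X) i j = A i 0 * X 0 j + A i 1 * X 1 j.
Proof. by rewrite mxE !big_ord_recl big_ord0 addr0; congr (_ * _ + _ * _);
  congr (fun_of_matrix _ _ _); apply: val_inj. Qed.

Lemma mxtrace22 A : \tr A = A 0 0 + A 1 1.
Proof. by rewrite /mxtrace !big_ord_recl big_ord0 addr0; congr (_ + A _ _);
  apply: val_inj. Qed.

Lemma det_mx22 A : \det A = A 0 0 * A 1 1 - A 0 1 * A 1 0.
Proof.
rewrite (expand_det_row _ ord0) !big_ord_recl big_ord0 addr0 /cofactor.
rewrite !det_mx11 !mxE /= expr0 expr1 mul1r mulN1r mulrN.
by congr (_ * _ - _ * _); congr (fun_of_matrix _ _ _); apply: val_inj.
Qed.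

Lemma tcmxE m n (A : 'M[C]_(m, n)) i j : (A ^t*) i j = (A j i)^*.
Proof. by rewrite !mxE. Qed.

Lemma tcmx_mul m n p (A : 'M[C]_(m, n)) (B : 'M[C]_(n, p)) :
  (A *m B)^t* = B^t* *m A^t*.
Proof. by rewrite trmx_mul map_mxM. Qed.

Lemma unitarymxPC n (A : 'M[C]_n) : A \is unitarymx -> A^t* *m A = 1%:M.
Proof. by move=> /unitarymxP/mulmx1C. Qed.

Lemma mx22X (z w : C) n : mx22 z 0 0 w ^+ n = mx22 (z ^+ n) 0 0 (w ^+ n).
Proof.
elim: n => [|n IH]; first by apply: mx22P; rewrite !expr0 !mxE.
rewrite !exprS IH -mulmxE.
by apply: mx22P; rewrite mulmx22 !mxE /=; ring.
Qed.

Lemma comm_diag_mx22 X (z w : C) : z != w ->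
  X *m mx22 z 0 0 w = mx22 z 0 0 w *m X -> X 0 1 = 0 /\ X 1 0 = 0.
Proof.
rewrite -subr_eq0 => zw XA.
have E i j := congr1 (fun M : 'M[C]_2 => M i j) XA.
split; apply/(mulfI zw); rewrite mulr0.
- by have := E 0 1; rewrite !mulmx22 !mxE /= => e; ring: e.
- by have := E 1 0; rewrite !mulmx22 !mxE /= => e; ring: e.
Qed.

Lemma su2_entries A : A \is unitarymx -> \det A = 1 ->
  A 1 1 = (A 0 0)^* /\ A 0 1 = - (A 1 0)^*.
Proof.
move=> uA; rewrite det_mx22 => dA.
have adjA : A *m mx22 (A 1 1) (- A 0 1) (- A 1 0) (A 0 0) = 1%:M.
  by apply: mx22P; rewrite mulmx22 !mxE /= -?dA; ring.
have /(congr1 (mulmx (A^t*))) := adjA.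
rewrite mulmxA unitarymxPC// mul1mx mulmx1 => e.
have E i j := congr1 (fun M : 'M[C]_2 => M i j) e.
by have := E 0 0; have := E 0 1; rewrite !mxE /= => <- ->; rewrite opprK.
Qed.

Lemma mx22_su2 (a c : C) : a * a^* + c * c^* = 1 ->
  mx22 a (- c^*) c a^* \is unitarymx /\ \det (mx22 a (- c^*) c a^*) = 1.
Proof.
move=> e; split; last by rewrite det_mx22 !mxE /= -e; ring.
have {}e : a * a^* = 1 - c * c^* by rewrite -e addrK.
apply/unitarymxP; apply: mx22P; rewrite mulmx22 !tcmxE !mxE /= ?rmorphN /= ?conjCK
  ?mulr1n ?mulr0n; ring: e.
Qed.

(** The matrix Y is a half turn about an axis orthogonal to that of A.  It is
    found off the diagonal, with lower left entry s; the relation with A then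
    reads Re (s * (A 1 0)^* ) = 0, solved by a unit multiple of i * A 1 0. *)
Lemma su2_half_turn A : A \is unitarymx -> \det A = 1 ->
  exists Y : 'M[C]_2, [/\ Y \is unitarymx, \det Y = 1, Y *m Y = - 1%:M &
    Y *m A = A^t* *m Y].
Proof.
move=> uA dA; have [A11 A01] := su2_entries uA dA.
have [s s1 sq] : exists2 s : C, s * s^* = 1 & s * (A 1 0)^* + s^* * A 1 0 = 0.
  have [->|q0] := eqVneq (A 1 0) 0.
    by exists 1; rewrite ?conjC0 ?conjC1 ?mulr0 ?addr0 ?mulr1.
  have n0 : `|A 1 0| != 0 by rewrite normr_eq0.
  exists ('i * A 1 0 / `|A 1 0|).
    rewrite !rmorphM /= fmorphV /= conjCi (CrealP (normr_real _)).
    transitivity (- 'i ^+ 2 * (A 1 0 * (A 1 0)^* / `|A 1 0| ^+ 2)); first by field.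
    by rewrite sqrCi opprK mul1r -normCK divff// expf_neq0.
  rewrite !rmorphM /= fmorphV /= conjCi (CrealP (normr_real _)).
  by ring.
have {}sq : s * (A 1 0)^* = - (s^* * A 1 0) by apply/eqP; rewrite -addr_eq0 sq.
have [|uY dY] := @mx22_su2 0 s; first by rewrite mul0r add0r.
exists (mx22 0 (- s^*) s 0^*); split=> //.
  by apply: mx22P; rewrite mulmx22 !mxE /= ?rmorph0 -?s1; ring.
apply: mx22P; rewrite !mulmx22 !tcmxE !mxE /= ?rmorph0 ?A11 ?A01 ?rmorphN /= ?conjCK;
  ring: sq.
Qed.

(** Unitary matrices are unitarily diagonalizable, and on the diagonal one
    extracts complex roots; the two diagonal entries are conjugate because the
    determinant is 1, so their roots can be chosen conjugate too. *)
Lemma su2_root A n : (0 < n)%N -> A \is unitarymx -> \det A = 1 ->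
  exists B : 'M[C]_2, [/\ B \is unitarymx, \det B = 1 & B ^+ n = A].
Proof.
move=> n0 uA dA.
have nA : A \is normalmx.
  by apply/normalmxP; rewrite unitarymxPC// (unitarymxP uA).
have /orthomx_spectralP := nA; set P := spectralmx A; set d := spectral_diag A.
have uP : P \is unitarymx := spectral_unitarymx A.
rewrite invmx_unitary// => AE.
have DE : diag_mx d = P *m A *m P^t*.
  by rewrite AE !mulmxA (unitarymxP uP) mul1mx mulmxtVK.
have uD : diag_mx d \is unitarymx by rewrite DE !mul_unitarymx// trmxC_unitary.
have dD : \det (diag_mx d) = 1.
  rewrite DE !det_mulmx dA mulr1 -det_mulmx (unitarymxP uP) ?det1//.
have [D11 D01] := su2_entries uD dD.
have := congr1 (fun M : 'M[C]_2 => M 0 0) (unitarymxP uD).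
rewrite mulmx22 !tcmxE /=; move: D11 D01; rewrite ![diag_mx _ _ _]mxE ![1%:M _ _]mxE /=.
rewrite !mulr1n !mulr0n mul0r addr0 => d1 _ d0.
set w := n.-root (d 0 0).
have wn : w ^+ n = d 0 0 by rewrite /w rootCK.
have ww : w * w^* = 1.
  rewrite -normCK; apply/eqP; rewrite -(@pexpr_eq1 _ _ n) ?exprn_ge0//.
  by rewrite -exprM mulnC exprM -normrX wn normCK d0.
have [|uW dW] := @mx22_su2 w 0; first by rewrite mul0r addr0.
move: uW dW; set W := mx22 _ _ _ _ => uW dW.
have Wn : W ^+ n = diag_mx d.
  rewrite /W rmorph0 oppr0 mx22X -rmorphXn /= wn -d1.
  by apply: mx22P; rewrite !mxE.
exists (P^t* *m W *m P); split.
- by rewrite !mul_unitarymx// trmxC_unitary.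
- by rewrite !det_mulmx dW mulr1 -det_mulmx unitarymxPC ?det1.
rewrite AE -Wn; elim: (n) => [|m IH].
  by rewrite !expr0 mulmx1 unitarymxPC.
by rewrite !exprS IH -!mulmxE -!mulmxA (mulmxA P) (unitarymxP uP) mul1mx.
Qed.

(** Modulo 5 the Gaussian integer 3 + 4i is idempotent. *)
Lemma gauss_power n : exists u v : int,
  (3%:R + 4%:R * 'i : C) ^+ n.+1
    = (5%:Z * u + 3%:Z)%:~R + (5%:Z * v + 4%:Z)%:~R * 'i.
Proof.
elim: n => [|n [u [v IH]]].
  by exists 0, 0; rewrite expr1 !mulr0 !add0r.
exists (3%:Z * u - 4%:Z * v - 2%:Z), (4%:Z * u + 3%:Z * v + 4%:Z).
rewrite exprS IH; have := sqrCi C => e; ring: e.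
Qed.

(** A point of the unit circle with rational coordinates, of infinite order. *)
Definition rational_rotation : C := (3%:R + 4%:R * 'i) / 5%:R.

Lemma conj_rational_rotation : rational_rotation^* = (3%:R - 4%:R * 'i) / 5%:R.
Proof.
rewrite /rational_rotation rmorphM fmorphV /= rmorphD rmorphM /= conjCi.
by rewrite !conjC_nat mulrN.
Qed.

Lemma rational_rotation_unit : rational_rotation * rational_rotation^* = 1.
Proof.
rewrite conj_rational_rotation /rational_rotation; have := sqrCi C => e.
have n5 : (5%:R : C) != 0 by rewrite pnatr_eq0.
by field: e.
Qed.

(** The imaginary part of (3 + 4i)^(n+1) is 4 modulo 5, hence not 0. *)
Lemma rational_rotationX_neq_conj n :
  rational_rotation ^+ n.+1 != rational_rotation^* ^+ n.+1.
Proof.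
rewrite -rmorphXn /= /rational_rotation expr_div_n; have [u [v ->]] := gauss_power n.
rewrite rmorphM fmorphV /= rmorphXn /= conjC_nat.
rewrite (rmorphD Num.conj) /= [(_ * 'i)^*]rmorphM /= conjCi.
rewrite !rmorph_int mulrN; apply/eqP => /(mulIf _) e.
have {e} := e _; rewrite invr_eq0 expf_neq0 ?pnatr_eq0// => /(_ isT) /addrI /eqP.
rewrite -addr_eq0 -mulr2n mulrn_eq0 /= mulf_eq0 (negPf (neq0Ci _)) orbF intr_eq0 => /eqP.
by lia.
Qed.
End matrices22.

(** * Powers in subgroups of finite index *)

Section finite_index.
Variable G : groupType.

(** By pigeonhole two of the powers y^0, ..., y^(size s) lie in the same coset,
    so y^d lies in K for some 0 < d <= size s, and d divides (size s)!. *)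
Lemma power_in_finite_index (K : set G) (s : seq G) (y : G) :
  (forall x z, K x -> K z -> K (x^-1 * z)%g) ->
  (forall x, exists2 r, r \in s & K (r^-1 * x)%g) ->
  K (y ^+ (size s)`!)%g.
Proof.
move=> KF cover.
have /choice[r rP] k : exists r, r \in s /\ K (r^-1 * y ^+ k)%g.
  by have [r] := cover (y ^+ k)%g; exists r.
have : ~~ uniq (map r (iota 0 (size s).+1)).
  apply/negP => ur.
  have /(uniq_leq_size ur) : {subset map r (iota 0 (size s).+1) <= s}.
    by move=> _ /mapP[k _ ->]; case: (rP k).
  by rewrite size_map size_iota ltnn.
move=> /(uniqPn 1%g)[i [j [ij]]]; rewrite size_map size_iota => js.
rewrite !(nth_map 0%N) ?size_iota ?(ltn_trans ij)// !nth_iota ?(ltn_trans ij)//.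
rewrite !add0n => rij.
have Kd : K (y ^+ (j - i))%g.
  have := KF _ _ (rP i).2 (rP j).2.
  rewrite -rij invgM invgK -mulgA mulVKg.
  by rewrite -{1}(subnKC (ltnW ij)) expgnDr mulKg.
have K1 : K 1%g by have := KF _ _ Kd Kd; rewrite mulVg.
have KX m : K (y ^+ (j - i) ^+ m)%g.
  elim: m => [//|m IH]; rewrite expgS.
  have := KF _ _ (KF _ _ Kd K1) IH.
  by rewrite mulg1 invgK.
have /dvdnP[q ->] : (j - i %| (size s)`!)%N.
  by rewrite dvdn_fact// subn_gt0 ij /= (leq_trans (leq_subr _ _)).
by rewrite mulnC expgnA.
Qed.

Lemma finite_index_cover (H : groupClosed G) : finite_index H ->
  exists s : seq G, forall x, exists2 r, r \in s & (r^-1 * x)%g \in H.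
Proof.
move=> /finite_seqP[cs csE].
exists (map (xget 1%g) cs) => x.
pose c := [set (x * h)%g | h in [set` H]].
have cc : c \in cs.
  have : [set` cs] c by rewrite -csE; exists x.
  by [].
exists (xget 1%g c); first exact: map_f.
have [h /= hH <-] : c (xget 1%g c).
  by apply: (@xgetPex _ 1%g c); exists x; exists 1%g; rewrite ?mulg1//; exact: gpred1.
by rewrite invgM mulgVK gpredV.
Qed.

Lemma finite_index_power (H : groupClosed G) : finite_index H ->
  exists n, forall y : G, (y ^+ n.+1)%g \in H.
Proof.
move=> /finite_index_cover[s cover].
exists ((size s)`!.-1) => y; rewrite prednK ?fact_gt0//.
apply: (@power_in_finite_index [set` H]) => // x z /= xH zH.
by rewrite gpredMl// gpredV.
Qed.
End finite_index.

(** * The group SU(2) *)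

Section SU2_algebra.
Variable R : realType.
Implicit Types x y g : SU2 R.

Lemma SU2_mxM x y : SU2_mx (x * y)%g = SU2_mx x *m SU2_mx y.
Proof. by []. Qed.

Lemma SU2_mxV x : SU2_mx x^-1%g = (SU2_mx x)^t*.
Proof. by rewrite -invmx_unitary//; case: (SU2_mxP x). Qed.

Lemma SU2_mxX x n : SU2_mx (x ^+ n)%g = SU2_mx x ^+ n.
Proof.
by elim: n => [//|n IH]; rewrite expgS SU2_mxM IH exprS.
Qed.

Lemma SU2_mx_ex (A : 'M[Cplx R]_2) : A \is unitarymx -> \det A = 1 ->
  exists x, SU2_mx x = A.
Proof.
move=> uA dA; have sA : A \in @special_unitary R by apply/mem_set; split.
by exists (SigSub sA : SU2 R).
Qed.

Lemma SU2_root x n : exists y, (y ^+ n.+1)%g = x.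
Proof.
have [ux dx] := SU2_mxP x.
have [B [uB dB Bn]] := @su2_root _ (SU2_mx x) n.+1 isT ux dx.
have [y yB] := SU2_mx_ex uB dB.
by exists y; apply: SU2_mx_inj; rewrite SU2_mxX yB.
Qed.

(** SU(2) is divisible: every element is an N-th power, for N the exponent that
    sends all elements into K. *)
Lemma SU2_finite_index (K : set (SU2 R)) (s : seq (SU2 R)) :
  (forall x z, K x -> K z -> K (x^-1 * z)%g) ->
  (forall x, exists2 r, r \in s & K (r^-1 * x)%g) -> K = setT.
Proof.
move=> KF cover; apply/seteqP; split=> // x _.
have [y <-] := SU2_root x ((size s)`!.-1).
by rewrite prednK ?fact_gt0//; apply: power_in_finite_index.
Qed.

(** Square roots of -1, which act on traceless matrices as rotations by pi. *)
Definition half_turns : set (SU2 R) :=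
  [set w | SU2_mx w *m SU2_mx w = - 1%:M].

(** If y c y^-1 = c^-1 then (y^-1 c)^2 = y^-2.  The element y is far from all
    powers of g at once. *)
Lemma half_turn_inverts g : exists y, forall c : SU2 R,
  (exists n, c = (g ^+ n)%g \/ c = (g ^- n)%g) ->
  half_turns (y^-1 * c)%g.
Proof.
have [ug dg] := SU2_mxP g.
have [Y [uY dY YY Yg]] := su2_half_turn ug dg.
have [y yY] := SU2_mx_ex uY dY.
have yg : (y * g = g^-1 * y)%g.
  by apply: SU2_mx_inj; rewrite !SU2_mxM SU2_mxV yY.
have ygn n : (y * g ^+ n = g ^- n * y)%g.
  elim: n => [|n IH]; first by rewrite expg0 invg1 mulg1 mul1g.
  by rewrite {1}expgSr mulgA IH -mulgA yg mulgA -invgM -expgS.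
have ygV n : (y * g ^- n = g ^+ n * y)%g.
  by apply: (mulgI (g ^- n)%g); rewrite mulKg mulgA -ygn mulgK.
exists y => c [n cE].
have {cE}cyc : (c * y * c = y)%g.
  by case: cE => ->; rewrite -mulgA ?ygn ?ygV ?mulVKg ?mulKg.
change (SU2_mx (y^-1 * c * (y^-1 * c))%g = - 1%:M).
have -> : (y^-1 * c * (y^-1 * c) = y^-1 * y^-1)%g.
  have cV : (c^-1 * (y^-1 * c^-1) = y^-1)%g by rewrite -[in RHS]cyc !invgM mulgA.
  by rewrite -[X in (_ * (X * c))%g]cV !mulgA mulgK mulgVK.
rewrite SU2_mxM !SU2_mxV yY -tcmx_mul YY raddfN /= map_mxN trmx1 map_mx1.
by [].
Qed.

(** A matrix that commutes with a power of the diagonal rotation a is diagonal,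
    because this power has distinct eigenvalues.  The rotation b is the conjugate
    of a by the real matrix k with rows (3, -4) / 5 and (4, 3) / 5, so conjugating
    a diagonal X by k must give a diagonal matrix again; its upper right entry is
    12 / 25 times the difference of the diagonal entries of X. *)
Lemma independent_rotations : exists a b : SU2 R,
  forall n m (X : 'M[Cplx R]_2),
    X *m SU2_mx (a ^+ n.+1)%g = SU2_mx (a ^+ n.+1)%g *m X ->
    X *m SU2_mx (b ^+ m.+1)%g = SU2_mx (b ^+ m.+1)%g *m X ->
  X = (X 0 0)%:M.
Proof.
pose z := rational_rotation (Cplx R).
have [|ua da] := @mx22_su2 _ z 0; first by rewrite mul0r addr0 rational_rotation_unit.
have [|uk dk] := @mx22_su2 (Cplx R) (3%:R / 5%:R) (4%:R / 5%:R).
  rewrite !rmorphM /= !fmorphV /= !conjC_nat.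
  have n5 : (5%:R : Cplx R) != 0 by rewrite pnatr_eq0.
  by field.
have [a aE] := SU2_mx_ex ua da; have [k kE] := SU2_mx_ex uk dk.
have aX n : SU2_mx (a ^+ n.+1)%g = mx22 (z ^+ n.+1) 0 0 (z^* ^+ n.+1).
  by rewrite SU2_mxX aE rmorph0 oppr0 mx22X.
exists a, (a ^ k)%g => n m X Xa.
rewrite -conjXg conjgE !SU2_mxM SU2_mxV => Xb.
have uk' := SU2_mxP k.
move: Xa; rewrite aX => /comm_diag_mx22.
rewrite rational_rotationX_neq_conj => -[//|X01 X10].
have := congr1 (fun M => SU2_mx k *m M *m (SU2_mx k)^t*) Xb.
have kk : SU2_mx k *m (SU2_mx k)^t* = 1%:M by apply/unitarymxP; case: uk'.
rewrite -!mulmxA kk mulmx1 !mulmxA kk mul1mx.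
rewrite -!(mulmxA (SU2_mx (a ^+ m.+1)%g)) aX => /comm_diag_mx22.
rewrite rational_rotationX_neq_conj => -[//|K01 _].
move: K01; rewrite kE !mulmx22 !tcmxE !mxE /= X01 X10 conjCK.
have -> : (4%:R / 5%:R : Cplx R)^* = 4%:R / 5%:R.
  by rewrite rmorphM /= fmorphV /= !conjC_nat.
move=> K01.
have n5 : (5%:R : Cplx R) != 0 by rewrite pnatr_eq0.
have n12 : (12%:R : Cplx R) != 0 by rewrite pnatr_eq0.
have X11 : X 0 0 = X 1 1.
  apply/eqP; rewrite -subr_eq0; apply/eqP/(mulfI n12); rewrite mulr0.
  transitivity (25%:R * 0 : Cplx R); last by rewrite mulr0.
  by rewrite -[in RHS]K01; field.
by apply: mx22P; rewrite mxE /= ?mulr1n ?mulr0n.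
Qed.
End SU2_algebra.

(** * Completeness of the complex field *)

Section complex_complete.
Variable R : realType.

Lemma Cplx_pos (e : Cplx R) : 0 < e -> exists2 r : R, 0 < r & e = (r%:C)%C.
Proof.
move=> e0; exists (complex.Re e).
  by move: e0; rewrite ltcE => /andP[].
by rewrite RRe_real// ger0_real// ltW.
Qed.

Lemma ler_Re (z : Cplx R) : `|complex.Re z|%:C%C <= `|z|.
Proof. exact: normc_ge_Re. Qed.

Lemma ler_Im (z : Cplx R) : `|complex.Im z|%:C%C <= `|z|.
Proof.
have -> : complex.Im z = - complex.Re (z * 'i%C) by rewrite ReiNIm opprK.
rewrite normrN (le_trans (ler_Re _))// normrM.
have -> : `|'i%C : R[i]| = 1 by rewrite normc_def /= expr0n expr1n add0r sqrtr1.
by rewrite mulr1.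
Qed.

Lemma normC_le_ReIm (z : Cplx R) :
  `|z| <= (`|complex.Re z| + `|complex.Im z|)%:C%C.
Proof.
rewrite {1}[z]complexE (le_trans (ler_normD _ _))// normrM.
have -> : `|'i%C : R[i]| = 1 by rewrite normc_def /= expr0n expr1n add0r sqrtr1.
rewrite mul1r rmorphD /= lerD//.
- by rewrite normc_def /= expr0n addr0 sqrtr_sqr.
- by rewrite normc_def /= expr0n addr0 sqrtr_sqr.
Qed.

Lemma Cplx_complete (F : set_system (Cplx R)) :
  ProperFilter F -> cauchy F -> cvg F.
Proof.
move=> FF /cauchy_ballP Fc.
have part (f : Cplx R -> R) : (forall x y, f (x - y) = f x - f y) ->
    (forall z, `|f z|%:C%C <= `|z|) -> cvg (f @ F).
  move=> fB fle; apply: cauchy_cvg; apply/cauchy_ballP => e e0.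
  rewrite near_map2.
  have eC : 0 < (e%:C)%C :> Cplx R by rewrite ltcR.
  move: (Fc _ eC); apply: filterS => -[x y] /=.
  rewrite -ball_normE /= => xy; rewrite -ball_normE /= -ltcR -fB.
  exact: le_lt_trans (fle _) xy.
have /cvg_ex[a aF] := part (@complex.Re R) ltac:(by case=> ? ? []) ler_Re.
have /cvg_ex[b bF] := part (@complex.Im R) ltac:(by case=> ? ? []) ler_Im.
apply/cvg_ex; exists (a +i* b)%C; apply/cvgrPdist_lt => e /Cplx_pos[r r0 ->].
have r2 : 0 < r / 2 by rewrite divr_gt0.
near=> z; rewrite (le_lt_trans (normC_le_ReIm _))// ltcR.
have -> : r = r / 2 + r / 2 by rewrite -splitr.
apply: ltrD.
- near: z; move/cvgrPdist_lt: aF => /(_ _ r2); apply: filterS => z.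
  by case: z.
- near: z; move/cvgrPdist_lt: bF => /(_ _ r2); apply: filterS => z.
  by case: z.
Unshelve. all: by end_near. Qed.

End complex_complete.

HB.instance Definition _ (R : realType) :=
  Uniform_isComplete.Build (Cplx R) (@Cplx_complete R).

(** * Matrices as a Hilbert space *)

Section frobenius_form.
Variables (C : numClosedFieldType) (m n : nat).
Local Notation form := (form_of_matrix (@Num.conj C) 1%:M).

Definition frob_dot (A B : 'M[C]_(m, n)) : C := form A B.
HB.instance Definition _ := Bilinear.copy frob_dot form.
HB.instance Definition _ := Hermitian.copy frob_dot form.

Lemma frob_dotE A B : frob_dot A B = \tr (A *m B^t*).
Proof. by rewrite /frob_dot /form_of_matrix mulmx1. Qed.

Lemma frob_dot_sum A : frob_dot A A = \sum_i \sum_j `|A i j| ^+ 2.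
Proof.
rewrite frob_dotE /mxtrace; apply: eq_bigr => i _; rewrite mxE.
by apply: eq_bigr => j _; rewrite tcmxE normCK.
Qed.

Lemma frob_dot_gt0 A : A != 0 -> 0 < frob_dot A A.
Proof.
move=> A0; rewrite lt_def frob_dot_sum.
have pos i : 0 <= \sum_j `|A i j| ^+ 2 by apply: sumr_ge0 => j _; rewrite exprn_ge0.
rewrite sumr_ge0// andbT; apply: contra_neq A0 => s0.
apply/matrixP => i j; rewrite mxE.
have := @psumr_eq0P _ _ predT _ (fun i _ => pos i) s0 i isT => /psumr_eq0P r0.
have {r0}/eqP := r0 (fun _ _ => exprn_ge0 2 (normr_ge0 _)) j isT.
by rewrite expf_eq0 normr_eq0 => /eqP.
Qed.

HB.instance Definition _ := isDotProduct.Build _ _ frob_dot frob_dot_gt0.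

Lemma entry_le_frob (A : 'M[C]_(m, n)) i j : `|A i j| <= sqrtC (frob_dot A A).
Proof.
rewrite -[leLHS]sqrCK// ler_sqrtC ?nnegrE ?exprn_ge0 ?dnorm_ge0//.
rewrite frob_dot_sum (bigD1 i)//= (bigD1 j)//= -addrA lerDl addr_ge0//.
- by apply: sumr_ge0 => k _; rewrite exprn_ge0.
- by apply: sumr_ge0 => l _; apply: sumr_ge0 => k _; rewrite exprn_ge0.
Qed.
End frobenius_form.

(** A copy of the space of matrices on which the norm can be the Hilbert norm,
    since matrices already carry the maximum norm. *)
Definition frobenius (R : realType) (m n : nat) : Type := 'M[Cplx R]_(m, n).

Section frobenius.
Variables (R : realType) (m n : nat).
Local Notation V := (frobenius R m n).

HB.instance Definition _ := GRing.Lmodule.copy V 'M[Cplx R]_(m, n).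

Definition frob_norm (A : V) : Cplx R := sqrtC (frob_dot A A).

Fact frob_normD (A B : V) : frob_norm (A + B) <= frob_norm A + frob_norm B.
Proof. exact: (triangle_lerif (@frob_dot (Cplx R) m n)). Qed.

Fact frob_normZ (l : Cplx R) (A : V) : frob_norm (l *: A) = `|l| * frob_norm A.
Proof.
rewrite /frob_norm (dnormZ (@frob_dot (Cplx R) m n)).
by rewrite sqrtCM ?nnegrE ?exprn_ge0 ?dnorm_ge0// sqrCK.
Qed.

Fact frob_norm_eq0 (A : V) : frob_norm A = 0 -> A = 0.
Proof.
by move/eqP; rewrite (sqrt_dnorm_eq0 (@frob_dot (Cplx R) m n)) => /eqP.
Qed.

HB.instance Definition _ := Lmodule_isNormed.Build (Cplx R) V
  frob_normD frob_normZ frob_norm_eq0.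

Lemma frob_norm_le (A : V) : `|A| <= \sum_i \sum_j `|(A : 'M[Cplx R]_(m, n)) i j|.
Proof.
rewrite [X in `|X|](matrix_sum_delta (A : 'M[Cplx R]_(m, n))).
rewrite (le_trans (ler_norm_sum _ _ _))//; apply: ler_sum => i _.
rewrite (le_trans (ler_norm_sum _ _ _))//; apply: ler_sum => j _.
rewrite normrZ [X in _ * X](_ : _ = 1) ?mulr1//.
rewrite /Num.norm /= /frob_norm frob_dot_sum (bigD1 i)//= (bigD1 j)//= !mxE !eqxx.
rewrite big1 ?big1 ?addr0 ?normr1 ?expr1n ?sqrtC1// => [k ki|k kj].
- by rewrite big1// => l _; rewrite mxE (negPf ki) normr0 expr0n.
- by rewrite mxE (negPf kj) andbF normr0 expr0n.
Qed.

(** Entries are bounded by the norm and the norm by the sum of the entries, so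
    completeness for the maximum norm carries over. *)
Lemma frobenius_complete (F : set_system V) : ProperFilter F -> cauchy F -> cvg F.
Proof.
move=> FF /cauchy_ballP Fc.
have : cauchy (F : set_system 'M[Cplx R]_(m, n)).
  apply/cauchy_ballP => e e0; move: (Fc _ e0); apply: filterS => -[A B] /= AB.
  split=> // i j; rewrite -ball_normE /=.
  move: AB; rewrite -ball_normE /= => AB; apply: le_lt_trans AB.
  by have := entry_le_frob (A - B) i j; rewrite !mxE.
move=> /cauchy_cvg/cvg_ex[A AF]; apply/cvg_ex; exists A.
apply/(@cvgrPdist_lt _ V) => e e0.
have N0 : 0 < ((m * n).+1)%:R :> Cplx R by rewrite ltr0n.
have /AF : nbhs A (ball A (e / ((m * n).+1)%:R)).
  by apply: nbhsx_ballx; rewrite divr_gt0.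
apply: filterS => B [_ AB].
rewrite (le_lt_trans (frob_norm_le _))//.
apply: (@le_lt_trans _ _ (\sum_(i < m) \sum_(j < n) (e / ((m * n).+1)%:R))).
  apply: ler_sum => i _; apply: ler_sum => j _; apply: ltW.
  by have := AB i j; rewrite -ball_normE /= !mxE.
rewrite !sumr_const !card_ord -mulrnA -(mulr_natr (e / _)) mulrAC ltr_pdivrMr//.
by rewrite ltr_pM2l// ltr_nat mulnC.
Qed.

HB.instance Definition _ := Uniform_isComplete.Build V frobenius_complete.

Lemma frob_hilbert : hilbert (V := V) (@frob_dot (Cplx R) m n).
Proof. by move=> A; rewrite sqrtCK. Qed.
End frobenius.

(** * The adjoint representation *)

Section adjoint.
Variable C : numClosedFieldType.
Implicit Types (x y : 'rV[C]_3) (X : 'M[C]_2) (g h : 'M[C]_2).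

(** Coordinates of traceless matrices in the basis of Pauli matrices.  This basis
    is orthogonal with equal lengths, which makes [adjoint] below unitary. *)
Definition pauli x : 'M[C]_2 :=
  mx22 (x 0 ord_max) (x 0 0 - 'i * x 0 1) (x 0 0 + 'i * x 0 1) (- x 0 ord_max).

Definition pauli_coord X : 'rV[C]_3 :=
  \row_j (if j == 0 then (X 0 1 + X 1 0) / 2%:R else
          if j == 1 then 'i * (X 0 1 - X 1 0) / 2%:R
          else (X 0 0 - X 1 1) / 2%:R).

Let two0 : (2%:R : C) != 0. Proof. by rewrite pnatr_eq0. Qed.

Lemma rV3P x y : x 0 0 = y 0 0 -> x 0 1 = y 0 1 -> x 0 ord_max = y 0 ord_max ->
  x = y.
Proof.
move=> e0 e1 e2; apply/rowP => -[[|[|[|//]]] lek];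
  [rewrite -[LHS]/(x 0 _) (_ : Ordinal lek = 0)|
   rewrite (_ : Ordinal lek = 1)|rewrite (_ : Ordinal lek = ord_max)] => //;
  exact: val_inj.
Qed.

Lemma pauliK : cancel pauli pauli_coord.
Proof.
move=> x; have := sqrCi C => ii.
by apply: rV3P; rewrite !mxE /=; field: ii.
Qed.

Lemma pauli_coordK X : pauli (pauli_coord X) = X - (\tr X / 2%:R)%:M.
Proof.
have := sqrCi C => ii.
by apply: mx22P; rewrite !mxE /= mxtrace22 ?mulr1n ?mulr0n; field: ii.
Qed.

Lemma pauli_linear : linear pauli.
Proof. by move=> a x y; apply: mx22P; rewrite !mxE /=; ring. Qed.
HB.instance Definition _ := GRing.isLinear.Build C _ _ _ pauli pauli_linear.

Lemma pauli_coord_linear : linear pauli_coord.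
Proof. by move=> a x y; apply: rV3P; rewrite !mxE /=; ring. Qed.
HB.instance Definition _ := GRing.isLinear.Build C _ _ _ pauli_coord pauli_coord_linear.

Lemma tr_pauli x : \tr (pauli x) = 0.
Proof. by rewrite mxtrace22 !mxE /= subrr. Qed.

Lemma pauli_dot x y : \tr (pauli x *m (pauli y)^t*) = 2%:R * (x *m y^t*) 0 0.
Proof.
rewrite mxtrace22 !mulmx22 !tcmxE !mxE /= !big_ord_recl big_ord0 /= !mxE.
rewrite !rmorphB !rmorphD !rmorphN !rmorphM /= !conjCi.
rewrite (_ : lift ord0 (lift ord0 ord0) = ord_max :> 'I_3); last exact: val_inj.
rewrite (_ : lift ord0 ord0 = 1 :> 'I_3); last exact: val_inj.
have := sqrCi C => ii; ring: ii.
Qed.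

Definition conj_coord g x := pauli_coord (g *m pauli x *m g^t*).

Lemma conj_coord_linear g : linear (conj_coord g).
Proof.
move=> a x y; rewrite /conj_coord linearP mulmxDr mulmxDl -scalemxAr -scalemxAl.
by rewrite linearP.
Qed.
HB.instance Definition _ g :=
  GRing.isLinear.Build C _ _ _ (conj_coord g) (conj_coord_linear g).

(** Acting on row vectors from the right, so that the order of products is
    reversed ([adjointM]). *)
Definition adjoint g : 'M[C]_3 := lin1_mx (conj_coord g).

Lemma pauli_adjoint g x : g \is unitarymx ->
  pauli (x *m adjoint g) = g *m pauli x *m g^t*.
Proof.
move=> ug; rewrite mul_rV_lin1 /= pauli_coordK.
rewrite mxtrace_mulC mulmxA unitarymxPC// mul1mx tr_pauli mul0r.
by rewrite raddf0 subr0.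
Qed.

Lemma eq_mulmxl n (A B : 'M[C]_n) : (forall x : 'rV_n, x *m A = x *m B) -> A = B.
Proof. by move=> AB; apply/row_matrixP => i; rewrite !rowE. Qed.

Lemma adjointM g h : g \is unitarymx -> h \is unitarymx ->
  adjoint (g *m h) = adjoint h *m adjoint g.
Proof.
move=> ug uh; apply: eq_mulmxl => x; apply: (can_inj pauliK).
rewrite mulmxA !pauli_adjoint ?mul_unitarymx// tcmx_mul.
by rewrite !mulmxA.
Qed.

Lemma adjoint1 : adjoint 1%:M = 1%:M.
Proof.
apply: eq_mulmxl => x; apply: (can_inj pauliK).
have u1 : (1%:M : 'M[C]_2) \is unitarymx.
  by apply/unitarymxP; rewrite trmx1 map_mx1 mulmx1.
by rewrite pauli_adjoint// trmx1 map_mx1 !mulmx1 mul1mx.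
Qed.

Lemma adjoint_unitary g : g \is unitarymx -> adjoint g \is unitarymx.
Proof.
move=> ug; apply/unitarymxP; apply/matrixP => i j.
have := @pauli_dot ((delta_mx 0 i : 'rV_3) *m adjoint g)
  ((delta_mx 0 j : 'rV_3) *m adjoint g).
rewrite !pauli_adjoint// tcmx_mul tcmx_mul trmxCK !mulmxA.
rewrite -(mulmxA _ (g^t*) g) unitarymxPC// mulmx1.
rewrite -mulmxA mxtrace_mulC -!mulmxA (mulmxA (g^t*)) unitarymxPC// mul1mx.
rewrite mxtrace_mulC pauli_dot => /(mulfI two0).
have entry (A : 'M[C]_3) :
    ((delta_mx 0 i : 'rV_3) *m A *m (delta_mx 0 j : 'rV_3)^t*) 0 0 = A i j.
  by rewrite trmx_delta map_delta_mx -[_ *m A](rowE i A) -colE !mxE.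
by move=> e; rewrite -entry -[RHS]entry mulmx1 e tcmx_mul !mulmxA.
Qed.

Lemma adjoint_fixed g x : g \is unitarymx ->
  x *m adjoint g = x <-> pauli x *m g = g *m pauli x.
Proof.
move=> ug; split=> [xg|xg].
  by rewrite -{1}xg pauli_adjoint// -mulmxA unitarymxPC// mulmx1.
by apply: (can_inj pauliK); rewrite pauli_adjoint// -xg -mulmxA (unitarymxP ug) mulmx1.
Qed.

(** The axis is the traceless part of g, which commutes with g.  When it vanishes
    g is scalar and fixes everything. *)
Lemma adjoint_axis g : g \is unitarymx -> exists2 a : 'rV_3, a != 0 & a *m adjoint g = a.
Proof.
move=> ug; have [z|n0] := eqVneq (pauli_coord g) 0; last first.
  exists (pauli_coord g) => //; apply/adjoint_fixed => //.
  by rewrite pauli_coordK mulmxBl mulmxBr scalar_mxC.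
exists (delta_mx 0 0).
  by apply/eqP => /rowP/(_ 0) /eqP; rewrite !mxE /= oner_eq0.
apply/adjoint_fixed => //.
have : g = (\tr g / 2%:R)%:M.
  by apply/eqP; rewrite -subr_eq0 -pauli_coordK z linear0.
by move=> ->; rewrite scalar_mxC.
Qed.
End adjoint.

(** * Groups mapping to SU(2) without cyclic escape *)

Section adjoint_representation.
Variables (R : realType) (G : groupType) (phi : G -> SU2 R).
Hypothesis phiM : {morph phi : x y / (x * y)%g}.

Let V : completeNormedModType (Cplx R) := frobenius R 3 3.
Let dot : {dot V for Num.conj} := @frob_dot (Cplx R) 3 3.

Let Ad (g : G) : 'M[Cplx R]_3 := adjoint (SU2_mx (phi g)).

Definition adjoint_rep (g : G) (M : V) : V := (M : 'M[Cplx R]_3) *m Ad g.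

Let uphi g : SU2_mx (phi g) \is unitarymx. Proof. by case: (SU2_mxP (phi g)). Qed.

Let phi1 : phi 1%g = 1%g.
Proof. by apply: (mulgI (phi 1%g)); rewrite -phiM !mulg1. Qed.

Lemma adjoint_rep_unitary : unitary_rep dot adjoint_rep.
Proof.
split.
- by move=> g a M N; rewrite /adjoint_rep mulmxDl -scalemxAl.
- by apply/funext => M; rewrite /adjoint_rep /Ad phi1 adjoint1 mulmx1.
- move=> g h; apply/funext => M; rewrite /adjoint_rep /Ad /= phiM SU2_mxM.
  by rewrite adjointM// mulmxA.
- move=> g M N; rewrite /dot /= !frob_dotE tcmx_mul mulmxA mulmxtVK//.
  exact: adjoint_unitary.
Qed.

Lemma adjoint_rep_fixed (H : groupClosed G) (M : V) :
  fixed_vectors adjoint_rep H M <->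
  (forall h, h \in H -> forall i, row i M *m Ad h = row i M).
Proof.
split=> [Mfix h hH i|Mfix h hH]; first by rewrite -row_mul [_ *m _]Mfix.
by apply/row_matrixP => i; rewrite row_mul Mfix.
Qed.

(** The rows of a fixed matrix are coordinates of traceless matrices commuting
    with the image of H; being scalar and traceless, they vanish. *)
Lemma adjoint_rep_totally_ergodic :
  (forall H : groupClosed G, finite_index H -> forall X : 'M[Cplx R]_2,
     (forall h, h \in H -> X *m SU2_mx (phi h) = SU2_mx (phi h) *m X) ->
     X = (X 0 0)%:M) ->
  totally_ergodic_rep adjoint_rep.
Proof.
move=> scal H fH; apply/seteqP; split=> [M /adjoint_rep_fixed Mfix|_ -> h _];
  last by rewrite /adjoint_rep mul0mx.
apply/row_matrixP => i; apply: (can_inj (@pauliK _)).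
rewrite row0 linear0.
have /(scal H fH) : forall h, h \in H ->
    pauli (row i M) *m SU2_mx (phi h) = SU2_mx (phi h) *m pauli (row i M).
  by move=> h hH; apply/adjoint_fixed => //; exact: Mfix.
move: (pauli _) (tr_pauli (row i M)) => X trX XE.
move: trX; rewrite XE mxtrace_scalar => /eqP; rewrite mulrn_eq0 /= => /eqP ->.
by rewrite raddf0.
Qed.

Lemma adjoint_rep_cyclic (C : groupClosed G) (g : G) (M : V) :
  [set` C] = [set x | exists n, x = (g ^+ n)%g \/ x = (g ^- n)%g] ->
  fixed_vectors adjoint_rep C M <-> adjoint_rep g M = M.
Proof.
move=> CE; have inC x : (x \in C) = `[< exists n, x = (g ^+ n)%g \/ x = (g ^- n)%g >].
  apply/idP/asboolP => [xC|xC].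
  - have : [set` C] x by []. by rewrite CE.
  - have : [set` C] x by rewrite CE. by [].
have [_ r1 rM _] := adjoint_rep_unitary.
split=> [Mfix|gM].
  by apply: Mfix; rewrite inC; apply/asboolP; exists 1%N; rewrite expg1; left.
have gX n : adjoint_rep (g ^+ n)%g M = M.
  elim: n => [|n IH]; first by rewrite expg0 r1.
  rewrite expgS; apply: etrans (congr1 (fun f => f M) (rM _ _)) _.
  exact: etrans (congr1 (adjoint_rep g) IH) gM.
move=> h; rewrite inC => /asboolP[n [->|->]]; first exact: gX.
apply: etrans (congr1 (adjoint_rep (g ^- n)%g) (esym (gX n))) _.
apply: etrans (esym (congr1 (fun f => f M) (rM _ _))) _.
by rewrite mulVg r1.
Qed.

(** The vector u = a^* a has rows proportional to the axis a, so it is fixed, and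
    <1, u> = |a|^2 = |u|.  The projection w of 1 satisfies <w, u> = <1, u>, and
    Cauchy-Schwarz gives |w| >= 1. *)
Lemma adjoint_rep_projection (C : groupClosed G) : cyclic_subgroup C ->
  1 <= `|orthogonal_projection dot (fixed_vectors adjoint_rep C) (1%:M : V)|.
Proof.
(* An orthogonal projection has to be exhibited first, lest [xget] return its
   default value 0: the fixed vectors are the matrices with rows in a kernel, onto
   which matrices project. *)
move=> [g CE]; rewrite /orthogonal_projection.
set P := [set w | _]; have /(@xgetPex _ (0 : V)) : exists w, P w.
  pose U := kermx (Ad g - 1%:M).
  have UP (M : V) : fixed_vectors adjoint_rep C M <-> (M <= U)%MS.
    apply: iff_trans (adjoint_rep_cyclic _ CE) _; rewrite /adjoint_rep.
    by rewrite (sameP sub_kermxP eqP) mulmxBr mulmx1 subr_eq0; split => /eqP.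
  exists (1%:M *m proj_ortho U); split; first exact/UP/proj_ortho_sub.
  move=> N /UP /submxP[D ->]; rewrite /dot /= frob_dotE tcmx_mul mulmxA.
  have /orthomx1P -> := proj_ortho_compl_sub U (1%:M : 'M[Cplx R]_3).
  by rewrite mul0mx mxtrace0.
move: (xget _ _) => w [Ww worth].
have [a a0 ag] := adjoint_axis (uphi g).
pose u : V := a^t* *m a.
have Wu : fixed_vectors adjoint_rep C u.
  by apply/(adjoint_rep_cyclic _ CE); rewrite /adjoint_rep -mulmxA ag.
pose s := (a *m a^t*) 0 0.
have s0 : 0 < s by have := dotmx_is_dotmx a0; rewrite dotmxE.
have aa : a *m a^t* = s%:M by rewrite [LHS]mx11_scalar.
have vu : dot (1%:M : V) u = s.
  by rewrite /dot /= frob_dotE mul1mx tcmx_mul trmxCK mxtrace_mulC aa mxtrace_scalar.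
have uu : dot u u = s ^+ 2.
  rewrite /dot /= frob_dotE tcmx_mul trmxCK mulmxA -(mulmxA (a^t*)) aa.
  by rewrite mul_mx_scalar -scalemxAl mxtraceZ mxtrace_mulC aa mxtrace_scalar expr2.
have wu : dot w u = s.
  by have := worth _ Wu; rewrite linearBl /= vu => /eqP; rewrite subr_eq0 => /eqP.
have : `|dot w u| ^+ 2 <= dot w w * dot u u :=
  (CauchySchwarz (@frob_dot (Cplx R) 3 3) w u).1.
rewrite wu uu gtr0_norm// -[dot w w](frob_hilbert w) -[leLHS]mul1r.
rewrite ler_pM2r ?exprn_gt0//.
by rewrite -[X in X <= _](expr1n _ 2) ler_sqr ?nnegrE.
Qed.

Theorem not_cyclic_escape :
  (forall H : groupClosed G, finite_index H -> forall X : 'M[Cplx R]_2,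
     (forall h, h \in H -> X *m SU2_mx (phi h) = SU2_mx (phi h) *m X) ->
     X = (X 0 0)%:M) ->
  ~ cyclic_escape_property R G.
Proof.
move=> scal cep.
have := cep V dot adjoint_rep (@frob_hilbert R 3 3) adjoint_rep_unitary
  (adjoint_rep_totally_ergodic scal) (1%:M : V).
set S := [set r | _] => infS.
have : (1%:E <= ereal_inf S)%E.
  apply: le_ereal_inf_tmp => _ [C [cC _ ->]]; rewrite lee_fin.
  have := adjoint_rep_projection cC.
  by rewrite lecE => /andP[].
by rewrite infS lee_fin ler10.
Qed.
End adjoint_representation.

(** * Continuity of matrix expressions *)

Section matrix_continuity.
Variables (K : numFieldType) (T : topologicalType).

Lemma continuous_mx m n (f : T -> 'M[K]_(m, n)) :
  (forall i j, continuous (fun x => f x i j)) -> continuous f.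
Proof.
move=> cf x A [P Px PA].
have : \forall y \near x, forall ij : 'I_m * 'I_n, P ij.1 ij.2 (f y ij.1 ij.2).
  by apply: filter_forall => -[i j]; exact: (cf i j x _ (Px i j)).
by apply: filterS => y Py; apply: PA => i j; exact: (Py (i, j)).
Qed.

Lemma continuous_mulmx m n p (f : T -> 'M[K]_(m, n)) (g : T -> 'M[K]_(n, p)) :
  continuous f -> continuous g -> continuous (fun x => f x *m g x).
Proof.
move=> cf cg; apply: continuous_mx => i j x.
rewrite (_ : (fun y => _) = (fun y => \sum_k f y i k * g y k j)); last first.
  by apply/funext => y; rewrite mxE.
have : forall s : seq 'I_n, \sum_(k <- s) f y i k * g y k j @[y --> x] -->
    \sum_(k <- s) f x i k * g x k j.
  elim=> [|k s IH].
    by rewrite big_nil; under eq_fun do rewrite big_nil; exact: cvg_cst.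
  rewrite big_cons; under eq_fun do rewrite big_cons.
  apply: cvgD => //; apply: cvgM.
  - exact: (continuous_comp (cf x) (@coord_continuous _ _ _ i k _)).
  - exact: (continuous_comp (cg x) (@coord_continuous _ _ _ k j _)).
exact.
Qed.

Lemma closed_eq_mx m n (f g : T -> 'M[K]_(m, n)) :
  continuous f -> continuous g -> closed [set x | f x = g x].
Proof.
move=> cf cg.
have -> : [set x | f x = g x] = (fun x => f x - g x) @^-1` [set 0].
  apply/seteqP; split=> x /= fgx; first by rewrite fgx subrr.
  by apply/eqP; rewrite -subr_eq0 fgx.
have c0 : closed [set (0 : 'M[K]_(m, n))].
  apply: accessible_closed_set1; apply: hausdorff_accessible.
  exact: norm_hausdorff.
have cfg : continuous (fun x => f x - g x).
  by move=> x; apply: cvgB; [exact: cf|exact: cg].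
by move/continuous_closedP: cfg; apply.
Qed.
End matrix_continuity.

Lemma conjC_continuous (R : realType) : continuous (@Num.conj (Cplx R)).
Proof.
move=> z A /nbhs_ballP[e /= e0 eA]; apply/nbhs_ballP; exists e => //= w zw.
apply: eA; move: zw; rewrite -!ball_normE /=.
by rewrite -rmorphB norm_conjC.
Qed.

Lemma continuous_tcmx (R : realType) (T : topologicalType) m n
    (f : T -> 'M[Cplx R]_(m, n)) :
  continuous f -> continuous (fun x => (f x)^t*).
Proof.
move=> cf; apply: continuous_mx => i j.
rewrite (_ : (fun t => _) = (@Num.conj (Cplx R)) \o (fun t => f t j i)); last first.
  by apply/funext => t; rewrite tcmxE.
move=> t; apply: continuous_comp; last exact: conjC_continuous.
exact: (continuous_comp (cf t) (@coord_continuous _ _ _ j i _)).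
Qed.

Lemma continuous_tcmx_mul (R : realType) (T : topologicalType) m n p
    (f : T -> 'M[Cplx R]_(m, n)) (g : T -> 'M[Cplx R]_(m, p)) :
  continuous f -> continuous g ->
  continuous (fun x : T * T => (f x.1)^t* *m g x.2).
Proof.
move=> cf cg.
have c1 : continuous (fun x : T * T => f x.1).
  by move=> x; apply: (@continuous_comp _ _ _ fst f); [exact: cvg_fst|exact: cf].
have c2 : continuous (fun x : T * T => g x.2).
  by move=> x; apply: (@continuous_comp _ _ _ snd g); [exact: cvg_snd|exact: cg].
exact: continuous_mulmx (continuous_tcmx c1) c2.
Qed.

(** Meant for a group T of unitary matrices with the induced topology, where op is
    x^-1 y. *)
Lemma initial_ldiv_continuous (R : realType) (T : topologicalType) n
    (f : T -> 'M[Cplx R]_n) (op : T -> T -> T) :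
  (forall U, open U -> exists2 W, open W & U = f @^-1` W) ->
  (forall x y, f (op x y) = (f x)^t* *m f y) ->
  continuous f -> continuous (fun xy : T * T => op xy.1 xy.2).
Proof.
move=> fU fop cf; apply/continuousP => U /fU[W oW ->].
have /continuousP/(_ _ oW) := continuous_tcmx_mul cf cf.
by congr open; apply/seteqP; split=> -[x y] /=; rewrite fop.
Qed.

Lemma commutant_closed (R : realType) (T : topologicalType) n
    (f : T -> 'M[Cplx R]_n) (X : 'M[Cplx R]_n) :
  continuous f -> closed [set x | X *m f x = f x *m X].
Proof.
move=> cf; have cX : continuous (fun _ : T => X) by exact: cst_continuous.
exact: closed_eq_mx (continuous_mulmx cX cf) (continuous_mulmx cf cX).
Qed.

(** * Topological groups *)

HB.mixin Record isTopGroup G & monoid.Group G & Topological G := {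
  ldiv_continuous : continuous (fun xy : G * G => xy.1^-1 * xy.2 : G)%g
}.

#[short(type="topGroupType")]
HB.structure Definition TopGroup :=
  {G of isTopGroup G & monoid.Group G & PointedTopological G}.

Section top_group.
Variable G : topGroupType.
Implicit Types (x y z g : G) (U : set G).

Lemma nbhs_ldiv x y U : nbhs (x^-1 * y)%g U ->
  exists A B, [/\ nbhs x A, nbhs y B & forall a b, A a -> B b -> U (a^-1 * b)%g].
Proof.
move=> xyU; have [[A B] /= [xA yB] AB] := @ldiv_continuous G (x, y) U xyU.
by exists A, B; split=> // a b Aa Bb; exact: (AB (a, b)).
Qed.

Lemma lmul_continuous g : continuous (fun x => g * x : G)%g.
Proof.
move=> x U; rewrite -{1}(invgK g) => /nbhs_ldiv[A [B [gA xB AB]]].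
rewrite nbhs_simpl /=; apply: filterS xB => y By.
by have := AB _ _ (nbhs_singleton gA) By; rewrite invgK.
Qed.

Lemma inv_continuous : continuous (fun x => x^-1 : G)%g.
Proof.
move=> x U; rewrite -{1}(mulg1 x^-1%g) => /nbhs_ldiv[A [B [xA yB AB]]].
rewrite nbhs_simpl /=; apply: filterS xA => y Ay.
by have := AB _ _ Ay (nbhs_singleton yB); rewrite mulg1.
Qed.

Lemma rdiv_continuous y : continuous (fun x => x^-1 * y : G)%g.
Proof.
move=> x U => /nbhs_ldiv[A [B [xA yB AB]]].
rewrite nbhs_simpl /=; apply: filterS xA => z Az.
exact: AB (nbhs_singleton yB).
Qed.

Lemma open_lmul g U : open U -> open [set x | U (g * x)%g].
Proof. by move=> oU; move/continuousP: (@lmul_continuous g) => /(_ _ oU). Qed.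

Lemma open_inv U : open U -> open [set x : G | U x^-1%g].
Proof. by move=> oU; move/continuousP: inv_continuous => /(_ _ oU). Qed.

Lemma open_rdiv y U : open U -> open [set x : G | U (x^-1 * y)%g].
Proof. by move=> oU; move/continuousP: (@rdiv_continuous y) => /(_ _ oU). Qed.

Lemma open_rmul y U : open U -> open [set x : G | U (x * y)%g].
Proof.
move=> oU; rewrite (_ : mkset _ = [set x | [set z | U (z^-1 * y)%g] x^-1%g]).
  exact/open_inv/open_rdiv.
by apply/seteqP; split=> x /=; rewrite invgK.
Qed.

Lemma closure_subgroup (H : set G) :
  (forall x y, H x -> H y -> H (x^-1 * y)%g) ->
  forall x y, closure H x -> closure H y -> closure H (x^-1 * y)%g.
Proof.
move=> HF x y Hx Hy U /nbhs_ldiv[A [B [xA yB AB]]].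
have [a [Ha Aa]] := Hx _ xA; have [b [Hb Bb]] := Hy _ yB.
by exists (a^-1 * b)%g; split; [exact: HF|exact: AB].
Qed.

(** A finite union of translates of the closure of H is closed, and it contains a
    dense set. *)
Lemma closure_cover (D H : set G) (s : seq G) : dense D ->
  (forall x, D x -> exists2 r, r \in s & H (r^-1 * x)%g) ->
  forall x, exists2 r, r \in s & closure H (r^-1 * x)%g.
Proof.
move=> dD cover x; apply: contrapT => nx.
have : \forall y \near x, forall r, r \in s -> ~ H (r^-1 * y)%g.
  have : forall r, r \in s -> ~ closure H (r^-1 * x)%g.
    by move=> r rs Hr; apply: nx; exists r.
  elim: s {cover nx} => [|r s IH] ns; first by apply: nearW.
  have /IH xs : forall r, r \in s -> ~ closure H (r^-1 * x)%g.
    by move=> q qs; apply: ns; rewrite inE qs orbT.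
  have /existsNP[U /not_implyP[xU /set0P/negP/negPn/eqP HU]] := ns r (mem_head _ _).
  have rU : \forall y \near x, U (r^-1 * y)%g := @lmul_continuous _ _ _ xU.
  apply: filterS2 xs rU => y ys yU q; rewrite inE => /orP[/eqP ->|/ys//].
  by move=> Hq; have : (H `&` U) (r^-1 * y)%g by []; rewrite HU.
rewrite /prop_near1 nbhsE => -[U [oU Ux] nU].
have [y [Uy Dy]] := dD U (ex_intro _ x Ux) oU.
have [r rs Hr] := cover y Dy.
exact: nU Uy r rs Hr.
Qed.

End top_group.

(** * Invariant measures and dense subgroups *)

Section dense_subgroup.
Variable G : topGroupType.
Local Notation borel := (g_sigma_algebraType (@open G)).

Definition nbhs1_base (V : nat -> set G) : Prop :=
  [/\ forall n, open (V n), forall n, V n 1%g,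
      forall n m, (n <= m)%N -> V m `<=` V n &
      forall U, nbhs (1%g : G) U -> exists n, V n `<=` U].

Lemma open_measurable_borel (U : set G) : open U -> measurable (U : set borel).
Proof. exact: sub_sigma_algebra. Qed.

Lemma continuous_measurable_borel (f : G -> G) :
  (forall U, open U -> open (f @^-1` U)) ->
  forall B : set borel, measurable B -> measurable (f @^-1` B : set borel).
Proof.
move=> cf B mB; have mf : measurable_fun setT (f : borel -> borel).
  apply: (@measurability _ _ borel borel setT f (@open G) erefl) => // _ [U oU <-].
  by rewrite setTI; apply: open_measurable_borel; exact: cf.
by rewrite -[X in measurable X]setTI; exact: mf.
Qed.

Lemma measurable_lmul (g : G) (B : set borel) :
  measurable B -> measurable ([set x | B (g * x)%g] : set borel).
Proof. by apply: continuous_measurable_borel => U; exact: open_lmul. Qed.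

Lemma measurable_inv (B : set borel) :
  measurable B -> measurable ([set x : G | B x^-1%g] : set borel).
Proof. by apply: continuous_measurable_borel => U; exact: open_inv. Qed.

Lemma image_lmul (g : G) (B : set G) :
  [set (g * x)%g | x in B] = [set x | B (g^-1 * x)%g].
Proof.
apply/seteqP; split=> [_ [x Bx <-] /=|x Bx]; first by rewrite mulKg.
by exists (g^-1 * x)%g => //; rewrite mulVKg.
Qed.

Variables (V : nat -> set G) (Vbase : nbhs1_base V).

Let nbhs1_ldiv (U : set G) : nbhs (1%g : G) U -> exists n, forall v w,
  V n v -> V n w -> U (v^-1 * w)%g.
Proof.
move=> U1; have {}U1 : nbhs ((1%g : G)^-1 * 1)%g U by rewrite invg1 mulg1.
have [A [B [A1 B1 AB]]] := nbhs_ldiv U1.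
have [_ _ Vdec Vsub] := Vbase.
have [n nA] := Vsub _ A1; have [m mB] := Vsub _ B1.
exists (maxn n m) => v w vb wb; apply: AB.
- exact/nA/(Vdec _ _ (leq_maxl n m)).
- exact/mB/(Vdec _ _ (leq_maxr n m)).
Qed.

(** Choose d close to x, in x V_n^-1; then d V_n lies in x V_n^-1 V_n, which is
    inside U for n large. *)
Lemma dense_basis (D : set G) x (U : set G) : dense D -> nbhs x U ->
  exists d n, [/\ D d, V n (d^-1 * x)%g & forall y, V n (d^-1 * y)%g -> U y].
Proof.
have [Vopen V1 _ _] := Vbase.
move=> dD xU.
have {}xU : nbhs (x * 1)%g U by rewrite mulg1.
have [n nU] := nbhs1_ldiv (@lmul_continuous _ x _ _ xU).
have x0 : [set d | V n (d^-1 * x)%g] !=set0 by exists x; rewrite /= mulVg.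
have [d [xd Dd]] := dD _ x0 (open_rdiv x (Vopen n)).
exists d, n; split=> // y yd.
by have /= := nU _ _ xd yd; rewrite invgM invgK mulgA mulVKg mulVKg.
Qed.

Variables (D : set G) (countD : countable D) (denseD : dense D).

Let enum_D : exists e : nat -> G, forall d, D d -> exists n, e n = d.
Proof.
have /(@pcard_surjP G) [e es] := countD; exists e => d /es [n _ <-]; by exists n.
Qed.

(** Preimages of open sets are open in the product, but the product sigma-algebra
    only contains countable unions of boxes.  The translates of the V n by a
    countable dense set form a countable base, which suffices. *)
Lemma measurable_ldiv (B : set borel) : measurable B ->
  measurable ([set gx : borel * borel | B (gx.1^-1 * gx.2)%g] : set (borel * borel)).
Proof.
have [e eD] := enum_D; have [Vopen V1 _ _] := Vbase.
move=> mB.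
have mf : measurable_fun setT ((fun gx => gx.1^-1 * gx.2)%g : borel * borel -> borel).
  apply: (@measurability _ _ (borel * borel)%type borel setT _ (@open G) erefl) => //.
  move=> _ [U oU <-]; rewrite setTI.
  pose box (i : nat * nat) : set G := [set x | V i.2 ((e i.1)^-1 * x)%g].
  have mbox i : measurable (box i : set borel).
    exact: open_measurable_borel (open_lmul _ (Vopen _)).
  pose F (ij : (nat * nat) * (nat * nat)) : set (borel * borel) :=
    if `[< forall x y, box ij.1 x -> box ij.2 y -> U (x^-1 * y)%g >]
    then box ij.1 `*` box ij.2 else set0.
  rewrite (_ : _ @^-1` U = \bigcup_ij F ij).
    apply: countable_bigcupT_measurable => // ij; rewrite /F.
    case: ifP => _; last exact: measurable0.
    exact: measurableX.
  apply/seteqP; split=> [[x y] /= Uxy|[x y] [ij _]]; last first.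
    by rewrite /F; case: ifPn => // /asboolP UF [/=]; exact: UF.
  have [A [B' [xA yB AB]]] := nbhs_ldiv (open_nbhs_nbhs (conj oU Uxy)).
  have [d [n [/eD[i <-] dx dA]]] := dense_basis denseD xA.
  have [d' [m [/eD[j <-] dy dB]]] := dense_basis denseD yB.
  exists ((i, n), (j, m)) => //; rewrite /F ifT //.
  by apply/asboolP => a b /dA Aa /dB Bb; exact: AB.
by rewrite -[X in measurable X]setTI; exact: mf.
Qed.

Variables (R : realType) (mu : probability borel R).
Hypothesis mu_lmul : forall (g : G) (B : set borel), measurable B ->
  mu [set x | B (g * x)%g] = mu B.

(** Countably many translates of U cover the group. *)
Lemma open_positive (U : set G) : open U -> U !=set0 -> (0 < mu U)%E.
Proof.
move=> oU [u Uu]; rewrite lt_def measure_ge0 andbT; apply/negP => /eqP U0.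
have [e eD] := enum_D.
have mU := open_measurable_borel oU.
have : mu.-negligible (\bigcup_n [set x | U ((e n)^-1 * x)%g]).
  apply: negligible_bigcup => n; exists [set x | U ((e n)^-1 * x)%g]; split=> //.
  - exact: measurable_lmul.
  - by rewrite -U0; exact: mu_lmul.
rewrite (_ : \bigcup_n _ = setT).
  move=> /(measure_negligible (@measurableT _ borel)) T0.
  by have /eqP := probability_setT mu; rewrite T0 eq_sym onee_eq0.
apply/seteqP; split=> // x _.
have x0 : [set d | U (d^-1 * x)%g] !=set0.
  by exists (x * u^-1)%g; rewrite /= invgM invgK mulgVK.
have [d [Ud Dd]] := denseD x0 (open_rdiv x oU).
have [n en] := eD d Dd.
by exists n => //=; rewrite en.
Qed.

Section invariant_set.
Variables (H : set G) (B : set borel).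
Hypotheses (denseH : dense H) (mB : measurable B).
Hypothesis HB : forall h x, H h -> B (h * x)%g <-> B x.

(** The sets W n exhaust U, and W n stays in U under translation by V n.  Pick h in
    H with h g^-1 in V n; then g x in W n implies h x in U, and translation by h
    preserves both mu and B. *)
Let slice_le (U : set G) g : open U ->
  (mu ([set x | U (g * x)%g] `&` B) <= mu (U `&` B))%E.
Proof.
have [Vopen V1 Vdec Vsub] := Vbase => oU.
pose W n := [set x : G | forall v, V n v -> U (v * x)%g].
have mW n : measurable (W n : set borel).
  rewrite (_ : W n = ~` \bigcup_(y in ~` U) [set x : G | V n (y * x^-1)%g]).
    apply: measurableC; apply: open_measurable_borel; apply: bigcup_open => y _.
    exact: open_inv (open_lmul y (Vopen n)).
  apply/seteqP; split=> x /= Wx.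
    by move=> [y /= Uy Vy]; apply: Uy; have := Wx _ Vy; rewrite mulgVK.
  move=> v Vv; apply: contrapT => Uvx; apply: Wx; exists (v * x)%g => //=.
  by rewrite mulgK.
pose F n := [set x | W n (g * x)%g] `&` B.
have mF n : measurable (F n : set borel).
  by apply: measurableI => //; exact: measurable_lmul.
have FU : \bigcup_n F n = [set x | U (g * x)%g] `&` B.
  apply/seteqP; split=> [x [n _ [/= Wx Bx]]|x [/= Ux Bx]].
    by split=> //=; have := Wx _ (V1 n); rewrite mul1g.
  have Ux1 : nbhs (1%g : G) [set v | U (v * (g * x))%g].
    by apply: open_nbhs_nbhs; split; [exact: open_rmul|rewrite /= mul1g].
  by have [n nU] := Vsub _ Ux1; exists n => //; split=> //= v /nU.
have Fincr : nondecreasing_seq F.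
  move=> n m nm; apply/subsetPset => x [/= Wx Bx]; split=> // v /(Vdec _ _ nm).
  exact: Wx.
have mUB : measurable (U `&` B : set borel).
  by apply: measurableI => //; exact: open_measurable_borel.
have Fcvg := nondecreasing_cvg_mu (mu := mu) mF (bigcupT_measurable _ mF) Fincr.
rewrite -FU -(cvg_lim _ Fcvg)//; apply: lime_le; first exact: cvgP Fcvg.
apply: nearW => n.
have g0 : [set h | V n (h * g^-1)%g] !=set0 by exists g; rewrite /= mulgV.
have [h [/= hg Hh]] := denseH g0 (open_rmul g^-1%g (Vopen n)).
rewrite -(mu_lmul h mUB).
apply: le_measure; rewrite ?inE//; first exact: measurable_lmul.
move=> x [/= Wx Bx]; split=> /=; last exact/(HB x Hh).
by have := Wx _ hg; rewrite mulgA mulgVK.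
Qed.

(** The reverse inequality is [slice_le] for the inverse of g and the translate of
    U. *)
Let slice_open (U : set G) g : open U ->
  mu ([set x | U (g * x)%g] `&` B) = mu (U `&` B).
Proof.
move=> oU; apply/eqP; rewrite eq_le slice_le//=.
have := slice_le g^-1%g (open_lmul g oU); apply: le_trans.
rewrite (_ : [set x | _] = U)//; apply/seteqP; split=> x /=; by rewrite mulVKg.
Qed.

(** Both sides are finite measures in A that agree on open sets. *)
Lemma slice_invariant (A : set borel) g : measurable A ->
  mu ([set x | A (g * x)%g] `&` B) = mu (A `&` B).
Proof.
move=> mA.
have mg : measurable_fun setT ((fun x => g * x)%g : borel -> borel).
  by move=> _ E mE; rewrite setTI; exact: measurable_lmul.
(* The measure structure of a pushforward depends on a proof of measurability,
   so the instance is named here to pass it. *)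
pose m2 := measure_function_pushforward__canonical__measure_function_Measure
  (mrestr mu mB) mg.
have E U : open U -> m2 U = mrestr mu mB U by exact: slice_open.
have fin k : (m2 ((fun=> setT) (k : nat)) < +oo)%E.
  rewrite /m2 /= /pushforward /mrestr preimage_setT setTI.
  by rewrite (le_lt_trans (probability_le1 _ _)) ?ltry//.
have cov : \bigcup_k (fun=> setT : set borel) (k : nat) = setT.
  by rewrite bigcup_const//; exists 0%N.
have Q := @measure_unique _ R borel (@open G) (fun=> setT) erefl (@openI G)
  (fun=> openT) cov m2 (mrestr mu mB) E fin A mA.
exact: Q.
Qed.
End invariant_set.

(** Fubini for the set of pairs (g, x) with x in A and g^-1 x not in A: its slices
    at g are null by [slice_invariant], while its slice at x in A is the translate
    by x of the inverse of the complement of A. *)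
Lemma dense_subgroup_ergodic (H : set G) (B : set borel) :
  dense H -> measurable B -> (forall h x, H h -> B (h * x)%g <-> B x) ->
  mu B = 0%E \/ mu B = 1%E.
Proof.
move=> denseH mB HB.
have half (A : set borel) : measurable A -> (forall h x, H h -> A (h * x)%g <-> A x) ->
    (mu A * mu [set x | ~ A x^-1%g] = 0)%E.
  move=> mA HA; have mAc := measurableC mA.
  have mAV := measurable_inv mAc.
  pose E := [set gx : borel * borel | (~` A) (gx.1^-1 * gx.2)%g] `&` (setT `*` A).
  have mE : measurable E.
    by apply: measurableI; [exact: measurable_ldiv|exact: measurableX].
  have := indic_fubini_tonelli mu mu mE.
  rewrite indic_fubini_tonelli_FE// indic_fubini_tonelli_GE//.
  (* The slices of E at g are null. *)
  rewrite (eq_integral (fun=> 0%E)); last first.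
    move=> g _ /=; rewrite (_ : xsection E g = [set x | (~` A) (g^-1 * x)%g] `&` A).
      by rewrite (slice_invariant denseH mA HA _ mAc) setICl measure0.
    apply/seteqP; split=> x; rewrite /xsection /E /= inE /=.
      by move=> [? []].
    by move=> [? ?].
  rewrite integral0 => /esym.
  (* The slice of E at x in A consists of the g with x^-1 g in the inverse of ~` A. *)
  rewrite (eq_integral (fun x => mu [set x | ~ A x^-1%g] * (\1_A x)%:E)%E); last first.
    move=> x _ /=; rewrite indicE; have [xA|xA] := boolP (x \in A).
      rewrite mule1; have xA' : A x by exact: set_mem xA.
      rewrite -(mu_lmul x^-1%g mAV); congr (mu _).
      apply/seteqP; split=> y; rewrite /ysection /E /= inE /=.
        by move=> [yA _]; rewrite invgM invgK.
      by rewrite invgM invgK.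
    rewrite mule0 (_ : ysection E x = set0) ?measure0//.
    apply/seteqP; split=> y; rewrite /ysection /E /= ?inE //=.
    by move=> [_ [_ Ax]]; move/negP: xA; apply; exact: mem_set.
  rewrite ge0_integralZl//; last first.
    by apply/measurable_EFinP; exact: measurable_indic.
  by rewrite integral_indic// setIT muleC.
have mBc := measurableC mB.
have HBc h x : H h -> (~` B) (h * x)%g <-> (~` B) x.
  by move=> Hh; split=> /= nB xB; apply: nB; apply/(HB h x Hh).
have := half _ mB HB; have := half _ mBc HBc.
set b := mu [set x | ~ B x^-1%g]; set c := mu [set x | ~ (~` B) x^-1%g].
have bE : b = (1 - c)%E.
  rewrite -(probability_setC mu (measurable_inv (measurableC mBc))).
  by congr (mu _); apply/seteqP; split=> x /=; rewrite notK.
move=> /eqP; rewrite mule_eq0 => /orP[/eqP Bc0 _|/eqP c0].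
  by right; rewrite -(setCK B) probability_setC// Bc0 sube0.
rewrite bE c0 sube0 mule1; by left.
Qed.
End dense_subgroup.

(** * The topology of SU(2) *)

Section SU2_topology.
Variable R : realType.

Lemma SU2_mx_continuous : continuous (@SU2_mx R).
Proof. exact: initial_continuous. Qed.

Lemma SU2_ldiv_continuous :
  continuous (fun xy : SU2 R * SU2 R => xy.1^-1 * xy.2 : SU2 R)%g.
Proof.
apply: (@initial_ldiv_continuous R (SU2 R) 2 (@SU2_mx R) (fun x y => x^-1 * y)%g).
- by move=> _ [W oW <-]; exists W.
- by move=> x y; rewrite SU2_mxM SU2_mxV.
- exact: SU2_mx_continuous.
Qed.

HB.instance Definition _ := isTopGroup.Build (SU2 R) SU2_ldiv_continuous.

Definition SU2_ball n : set (SU2 R) :=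
  @SU2_mx R @^-1` (ball (1%:M : 'M[Cplx R]_2) (n.+1%:R^-1))°.

Lemma SU2_ball_base : nbhs1_base SU2_ball.
Proof.
have ball1 n : nbhs (1%:M : 'M[Cplx R]_2) (ball (1%:M : 'M[Cplx R]_2) (n.+1%:R^-1)).
  by apply: nbhsx_ballx; rewrite invr_gt0 ltr0n.
split.
- move=> n; exists (ball (1%:M : 'M[Cplx R]_2) (n.+1%:R^-1))° => //.
  exact: open_interior.
- by move=> n; exact: ball1.
- move=> n m nm; apply: preimage_subset; apply: interiorS; apply: le_ball.
  by rewrite lef_pV2 ?posrE ?ltr0n// ler_nat.
- move=> U [_ [[W oW <-] W1 WU]].
  have /nbhs_ballP[e /= e0 eW] : nbhs (1%:M : 'M[Cplx R]_2) W by exact: open_nbhs_nbhs.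
  have [r r0 eE] := Cplx_pos e0.
  have [n nr] : exists n, n.+1%:R^-1 < r.
    exists (Num.truncn r^-1).
    by rewrite invf_plt ?posrE ?ltr0n// truncnS_gt.
  exists n => x /interior_subset nx; apply: WU; apply: eW; apply: le_ball nx.
  by rewrite eE -(rmorph_nat (real_complex R)) -fmorphV lecR ltW.
Qed.

Lemma half_turns_closed : closed (@half_turns R).
Proof.
apply: closed_eq_mx; last exact: cst_continuous.
by apply: continuous_mulmx; exact: SU2_mx_continuous.
Qed.

(** At v = w = 1 the product v w^-1 is 1, which is not a square root of -1, and
    the square roots of -1 form a closed set. *)
Lemma avoid_half_turns : exists V : set (SU2 R),
  [/\ open V, V 1%g & forall v w, V v -> V w -> ~ half_turns (v * w^-1)%g].
Proof.
have q1 : nbhs ((1%g : SU2 R)^-1 * 1)%g (~` @half_turns R).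
  apply: open_nbhs_nbhs; split; first by rewrite openC; exact: half_turns_closed.
  rewrite invg1 mulg1 /half_turns /= mul1mx => /matrixP/(_ 0 0) /eqP.
  by rewrite !mxE /= -addr_eq0 -mulr2n pnatr_eq0.
have [A [B [A1 B1 AB]]] := nbhs_ldiv q1.
exists ([set v : SU2 R | A° v^-1%g] `&` [set v : SU2 R | B° v^-1%g]); split.
- by apply: openI; apply: open_inv; exact: open_interior.
- by split; rewrite /= invg1.
- move=> v w [/interior_subset Av _] [_ /interior_subset Bw].
  by have := AB _ _ Av Bw; rewrite invgK.
Qed.
End SU2_topology.

(** * Dense subgroups of SU(2) *)

Section dense_subgroup_of_SU2.
Variables (R : realType) (Gamma : groupClosed (SU2 R)).
Hypotheses (countGamma : countable [set` Gamma])
  (denseGamma : dense ([set` Gamma] : set (SU2 R))).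
Local Notation G := (subgroup_type Gamma).

Definition SU2_image (H : groupClosed G) : set (SU2 R) :=
  [set val h | h in [set` H]].

(** The closure of the image of H is a subgroup of finite index, hence everything. *)
Lemma finite_index_dense (H : groupClosed G) : finite_index H -> dense (SU2_image H).
Proof.
move=> /finite_index_cover[s cover] O [x Ox] oO.
suff : closure (SU2_image H) x.
  by move=> /(_ O (open_nbhs_nbhs (conj oO Ox))); rewrite setIC.
suff -> : closure (SU2_image H) = setT by [].
apply: (@SU2_finite_index R _ (map val s)).
  apply: closure_subgroup => _ _ [h hH <-] [k kH <-].
  by exists (h^-1 * k)%g => //=; apply: gpredM => //; rewrite gpredV.
apply: (closure_cover denseGamma) => g gG.
have [r rs rH] := cover (exist _ g gG : G).
exists (val r); first exact: map_f.
by exists (r^-1 * (exist _ g gG : G))%g.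
Qed.

Lemma dense_commutant (H : groupClosed G) (X : 'M[Cplx R]_2) : finite_index H ->
  (forall h, h \in H -> X *m SU2_mx (val h) = SU2_mx (val h) *m X) ->
  X = (X 0 0)%:M.
Proof.
move=> fH XH.
have XT x : X *m SU2_mx x = SU2_mx x *m X.
  apply: contrapT => nx.
  have [y [ny [h hH yE]]] := finite_index_dense fH (ex_intro _ x nx)
    (closed_openC (@commutant_closed R (SU2 R) 2 _ X (@SU2_mx_continuous R))).
  by apply: ny; rewrite -yE; exact: XH.
have [a [b ab]] := independent_rotations R.
exact: (ab 0%N 0%N).
Qed.

Lemma dense_subgroup_not_cyclic_escape : ~ cyclic_escape_property R G.
Proof.
apply: (@not_cyclic_escape R G val) => // H fH X; exact: dense_commutant.
Qed.

Variable m : probability (SU2_borel R) R.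
Hypothesis haar : haar_probability m.

Let m_lmul (g : SU2 R) (B : set (SU2_borel R)) : measurable B ->
  m [set x | B (g * x)%g] = m B.
Proof.
by move=> mB; rewrite -(haar g^-1%g mB) image_lmul invgK.
Qed.

Lemma translation_pmp : pmp_action m (@translation R Gamma).
Proof.
split.
- by apply/funext => x; exact: mul1g.
- by move=> g h; apply/funext => x; rewrite /translation /= mulgA.
- by move=> g _ B mB; rewrite setTI; exact: (@measurable_lmul (SU2 R)).
- by move=> g B mB; exact: m_lmul.
Qed.

Lemma translation_totally_ergodic :
  totally_ergodic_action m (@translation R Gamma).
Proof.
move=> H fH B mB HB.
apply: (@dense_subgroup_ergodic (SU2 R) _ (SU2_ball_base R) _ countGamma denseGamma
  R m m_lmul _ B (finite_index_dense fH) mB).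
move=> _ x [h hH <-]; have := HB h hH.
rewrite /translation image_lmul => {1}<- /=.
by rewrite mulKg.
Qed.

(** For C generated by g, the half turn y that inverts g satisfies yV `&` CV = set0:
    c v = y w would make y^-1 c = w v^-1 a square root of -1. *)
Lemma translation_not_expansive :
  ~ directionally_expansive m (@translation R Gamma).
Proof.
have [V [oV V1 Vq]] := avoid_half_turns R => expansive.
have mV : measurable (V : set (SU2_borel R)) := open_measurable_borel oV.
have V0 : (0 < m V)%E.
  exact: (@open_positive (SU2 R) _ countGamma denseGamma R m m_lmul V oV
    (ex_intro _ 1%g V1)).
have mVE : m V = (fine (m V))%:E by rewrite fineK// fin_num_measure.
have eps0 : 0 < fine (m V) by rewrite -lte_fin -mVE.
have [C [[g CE] Cbig]] := expansive V (fine (m V)) mV V0 eps0.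
move: Cbig; set CV := \bigcup_(c in _) _ => Cbig.
have [y yq] := half_turn_inverts (val g).
pose yV : set (SU2_borel R) := [set x | V (y^-1 * x)%g].
have myV : measurable yV by exact: (@measurable_lmul (SU2 R)).
have mCV : measurable CV.
  apply: (@open_measurable_borel (SU2 R)); apply: bigcup_open => c _.
  by rewrite /translation image_lmul; exact: open_lmul.
have disj : CV `&` yV = set0.
  apply/seteqP; split=> // _ [[c cC [v Vv <-]] yVx].
  apply: (Vq _ _ yVx Vv); rewrite /translation mulgA mulgK; apply: yq.
  have : [set` C] c := cC; rewrite CE => -[n cE]; exists n.
  by case: cE => ->; [left; exact: gmulfXn|right; exact: gmulfXVn].
have := probability_le1 m (measurableU _ _ mCV myV).
rewrite measureU//= (_ : m yV = m V); last exact: m_lmul.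
apply/negP; rewrite -ltNge mVE.
by rewrite -lteBlDr// -EFinB.
Qed.
End dense_subgroup_of_SU2.

(** * Free groups *)

Lemma free_not_cyclic_escape (R : realType) (F : groupType) (S : Type) (iota : S -> F) :
  free_basis iota -> (exists s t : S, s <> t) -> ~ cyclic_escape_property R F.
Proof.
move=> free [s [t st]].
have [a [b ab]] := independent_rotations R.
have [phi [[phiM phiE] _]] := free (SU2 R) (fun u => if `[< u = s >] then a else b).
have phis : phi (iota s) = a by rewrite phiE; case: asboolP.
have phit : phi (iota t) = b by rewrite phiE; case: asboolP => // /esym.
have phi1 : phi 1%g = 1%g by apply: (mulgI (phi 1%g)); rewrite -phiM !mulg1.
have phiX x n : phi (x ^+ n)%g = (phi x ^+ n)%g.
  by elim: n => [|n IH]; rewrite ?expg0 ?phi1// !expgS phiM IH.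
apply: (@not_cyclic_escape R F phi phiM) => H /finite_index_power[n Hn] X XH.
apply: (ab n n); rewrite -?phis -?phit -phiX; apply: XH; exact: Hn.
Qed.

(** * Dense subgroups of SU(2) and free groups lack cyclic escape *)

Theorem theorem1p7 (R : realType) :
  (forall Gamma : groupClosed (SU2 R),
     countable [set` Gamma] -> dense ([set` Gamma] : set (SU2 R)) ->
     (forall m : probability (SU2_borel R) R, haar_probability m ->
        [/\ pmp_action m (@translation R Gamma),
            totally_ergodic_action m (@translation R Gamma) &
            ~ directionally_expansive m (@translation R Gamma)]) /\
     ~ cyclic_escape_property R (subgroup_type Gamma)) /\
  (forall (F : groupType) (S : Type) (iota : S -> F),
     countable [set: F] -> free_basis iota -> (exists s t : S, s <> t) ->
     ~ cyclic_escape_property R F).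
Proof.
split=> [Gamma countGamma denseGamma|F S iota _]; last exact: free_not_cyclic_escape.
split=> [m haar|]; last exact: dense_subgroup_not_cyclic_escape.
split.
- exact: translation_pmp.
- exact: translation_totally_ergodic.
- exact: translation_not_expansive.
Qed.
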